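(* Let $d\geq 2$ be an integer and let $c^{(d)}_{k,n}$ ($k\in\mathbb{Z}$, $n\in\mathbb{Z}_{\geq 0}$) be the entries of the Catalan triangle of order $d$. Then for every $n\geq 0$, $$c_{1,2n}^{(d)}=\sum_{k>0}\bigl(c_{k,n}^{(d)}\bigr)^2 .$$
   Context: For $d\geq 2$, the Catalan triangle of order $d$ is the family of integers $c^{(d)}_{k,n}$ ($k\in\mathbb{Z}$, $n\in\mathbb{Z}_{\geq0}$) defined by the initial condition $c^{(d)}_{-1,0}=-1$, $c_{1,0}^{(d)}=1$, $c_{i,0}^{(d)}=0$ for all $i\neq-1,1$, and the recurrence $$c_{k,n+1}^{(d)}=c_{k-(d-1),n}^{(d)}+c_{k-(d-3),n}^{(d)}+\dots+c_{k+d-3,n}^{(d)}+c_{k+d-1,n}^{(d)}$$ (a sum of $d$ terms, with first indices in steps of $2$). For fixed $n$ only finitely many $c^{(d)}_{k,n}$ are non-zero. *)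

(* Defs.v *)
From mathcomp Require Import all_boot all_order all_algebra.
From mathcomp Require Import zify.
From mathcomp Require Import classical_sets functions cardinality fsbigop.

Set Implicit Arguments.
Unset Strict Implicit.
Unset Printing Implicit Defensive.

Import Order.TTheory GRing.Theory Num.Theory.

Local Open Scope classical_set_scope.
Local Open Scope ring_scope.

(* [catalan_triangle d n k] is c^(d)_{k,n}: the row [n] comes before the
   column [k], since the recursion is on [n].  The [d] terms of the recurrence
   have first indices k-(d-1), k-(d-3), ..., k+(d-1). *)
Fixpoint catalan_triangle (d n : nat) (k : int) : int :=
  if n is m.+1 then
    \sum_(j < d) catalan_triangle d m (k - (d%:Z - 1) + 2 * (j : nat)%:Z)
  else if k == 1 then 1 else if k == -1 then -1 else 0.

Lemma catalan_triangle_eq0 (d n : nat) (k : int) :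
  ((n * d.-1).+1 < `|k|)%N -> catalan_triangle d n k = 0.
Proof.
elim: n k => [|n IHn] k /= hk.
  by case: eqP => [?|_]; [lia|case: eqP => [?|//]; lia].
by rewrite big1 // => j _; apply: IHn; have := ltn_ord j; nia.
Qed.

(* Each row has finite support, so finitely supported sums ([fsbigop]), which
   default to 0 on infinite supports, have their expected meaning on it. *)
Lemma finite_catalan_triangle (d n : nat) :
  finite_set [set k | catalan_triangle d n k <> 0].
Proof.
set b := (n * d.-1).+1.
apply: (@sub_finite_set _ _ [set i%:Z - b%:Z | i in `I_(b + b).+1]);
  last exact: finite_image.
move=> k /= hk.
have kb : (`|k| <= b)%N.
  by rewrite leqNgt; apply/negP => /catalan_triangle_eq0.
by exists (absz (k + b%:Z)); rewrite /=; lia.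
Qed.

(* Main.v *)
Require Import Defs.
From mathcomp Require Import all_boot all_order all_algebra.
From mathcomp Require Import zify ring.
From mathcomp Require Import boolp classical_sets functions cardinality fsbigop.

Import Order.TTheory GRing.Theory Num.Theory.

Local Open Scope classical_set_scope.
Local Open Scope ring_scope.

(** Passing from one row of the triangle to the next is the operator
    [step d], a sum of [d] translations.  The set of translation lengths is
    symmetric about 0, so [step d] is self-adjoint for the pairing
    [<f, g> = \sum_k f k * g k] of finitely supported functions on the
    integers ([fsum_step_adjoint]).  Hence the pairing of rows [m] and [n]
    depends only on [m + n], and in particular
    [<c_0, c_2n> = <c_n, c_n>] ([fsum_catalan_triangle_shift]).

    Row 0 is odd and [step d] preserves odd functions
    ([catalan_triangleN]), so products of two rows are even and vanish at 0:
    each pairing is twice its sum over [k > 0] ([fsum_even]).  After cancelling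
    the 2, the right-hand side is the sum of the squares, and the left-hand
    side is the single term [c_{1,2n}], as 1 is the only positive index at
    which row 0 is nonzero. *)

(** * Finitely supported sums *)

(** Finitely supported sums default to 0 on infinite supports, so each summand
    must be finitely supported; the union of these supports is then a common
    finite range for all the sums. *)
Lemma exchange_fsum_sum (V : nmodType) (T : choiceType) (J : finType)
    (f : J -> T -> V) :
  (forall j, finite_set [set k | f j k <> 0]) ->
  \sum_(k \in [set: T]) \sum_(j : J) f j k =
  \sum_(j : J) \sum_(k \in [set: T]) f j k.
Proof.
move=> ff; pose A := \bigcup_(j in [set: J]) [set k | f j k <> 0].
have Afin : finite_set A by apply: bigcup_finite => // j _; exact: ff.
have f0 k : ~ A k -> forall j, f j k = 0.
  by move=> NAk j; apply: contrapT => fjk; apply: NAk; exists j.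
rewrite -(fsbig_widen A) //; last first.
  by move=> k [_ /f0 fk] /=; rewrite big1.
rewrite fsbig_finite// exchange_big; apply: eq_bigr => j _.
by rewrite -fsbig_finite//; apply: fsbig_widen => // k [_ /f0 fk]; exact: fk.
Qed.

Lemma fsum_even (V : nmodType) (h : int -> V) :
  finite_set [set k | h k <> 0] -> h 0 = 0 -> (forall k, h (- k) = h k) ->
  \sum_(k \in [set: int]) h k = (\sum_(k \in [set k : int | 0 < k]) h k) *+ 2.
Proof.
move=> hfin h0 hN; pose S := [set k | h k <> 0].
have <- : \sum_(k \in S) h k = \sum_(k \in [set: int]) h k.
  by apply: fsbig_widen => // k [_ /contrapT].
rewrite (fsbigID [set k | 0 < k])// mulr2n; congr (_ + _).
  by apply: fsbig_widen => [k []//|k [k0 /not_andP[/contrapT|/(_ k0)]]].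
rewrite (fsbig_widen _ [set k | k < 0]); first last.
- move=> k [/= k0 /not_andP[/contrapT//|/contrapT /=]]; lia.
- by move=> k [/= hk kN]; case: (ltgtP k 0) => // k0; rewrite k0 in hk.
rewrite (reindex_fsbig -%R [set k | 0 < k]); first exact: eq_fsbigr.
split=> [k /= | k l _ _ /oppr_inj // | k /= k0]; first by rewrite oppr_lt0.
by exists (- k); rewrite /= ?opprK ?oppr_gt0.
Qed.

(** * The row operator of the triangle *)

Definition step_shift (d j : nat) : int := 2 * j%:Z - (d%:Z - 1).

Definition step {R : nmodType} (d : nat) (f : int -> R) (k : int) : R :=
  \sum_(j < d) f (k + step_shift d j).

Lemma catalan_triangleS (d n : nat) :
  catalan_triangle d n.+1 = step d (catalan_triangle d n).
Proof.
apply/funext => k /=; apply: eq_bigr => j _.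
by congr catalan_triangle; rewrite /step_shift; ring.
Qed.

Lemma step_shift_rev (d : nat) (j : 'I_d) :
  step_shift d (rev_ord j) = - step_shift d j.
Proof. by rewrite /step_shift /=; have := ltn_ord j; lia. Qed.

(** Translation by [s] is adjoint to translation by [- s], and [rev_ord] matches
    each shift with its opposite. *)
Lemma fsum_step_adjoint (R : nzRingType) (d : nat) (f g : int -> R) :
  finite_set [set k | f k <> 0] ->
  \sum_(k \in [set: int]) step d f k * g k =
  \sum_(k \in [set: int]) f k * step d g k.
Proof.
move=> ffin.
under eq_fsbigr do rewrite mulr_suml.
under [RHS]eq_fsbigr do rewrite mulr_sumr.
rewrite !exchange_fsum_sum; first last.
- move=> j.
  apply: (sub_finite_set _ (finite_image (+%R^~ (- step_shift d j)) ffin)).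
  move=> k /= fgk; exists (k + step_shift d j); rewrite /= ?addrK//.
  by move=> fk; apply: fgk; rewrite fk mul0r.
- move=> j; apply: sub_finite_set ffin => k /= fgk fk.
  by apply: fgk; rewrite fk mul0r.
rewrite (reindex_inj rev_ord_inj); apply: eq_bigr => j _.
rewrite (reindex_fsbigT (+%R^~ (step_shift d j))).
  by apply: eq_fsbigr => k _; rewrite step_shift_rev addrK.
by exists (+%R^~ (- step_shift d j)) => k; rewrite ?addrK ?addrNK.
Qed.

Lemma stepN (R : zmodType) (d : nat) (f : int -> R) :
  (forall k, f (- k) = - f k) -> forall k, step d f (- k) = - step d f k.
Proof.
move=> fN k; rewrite /step -sumrN (reindex_inj rev_ord_inj).
by apply: eq_bigr => j _; rewrite step_shift_rev -opprD fN.
Qed.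

(** * Pairing rows of the triangle *)

Lemma catalan_triangleN (d n : nat) (k : int) :
  catalan_triangle d n (- k) = - catalan_triangle d n k.
Proof.
elim: n k => [|n IHn] k; last by rewrite catalan_triangleS; exact: stepN.
by rewrite /= eqr_oppLR eqr_opp; case: eqP => [->|_] //; case: eqP.
Qed.

Lemma catalan_triangle0 (d n : nat) : catalan_triangle d n 0 = 0.
Proof. by have := catalan_triangleN d n 0; rewrite oppr0 => /eqP; rewrite -addr_eq0 -mulr2n mulrn_eq0 => /eqP. Qed.

Lemma finite_catalan_triangleM (d m n : nat) :
  finite_set [set k | catalan_triangle d m k * catalan_triangle d n k <> 0].
Proof.
apply: sub_finite_set (finite_catalan_triangle d m) => k /= ck ck0.
by apply: ck; rewrite ck0 mul0r.
Qed.

(** Self-adjointness moves the applications of [step d] one at a time from the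
    right factor to the left one. *)
Lemma fsum_catalan_triangle_shift (d m n : nat) :
  \sum_(k \in [set: int]) catalan_triangle d 0 k * catalan_triangle d (m + n) k
  = \sum_(k \in [set: int]) catalan_triangle d m k * catalan_triangle d n k.
Proof.
elim: m n => [//|m IHm] n; rewrite addSnnS IHm !catalan_triangleS.
by rewrite fsum_step_adjoint//; exact: finite_catalan_triangle.
Qed.

Lemma fsum_catalan_triangle_half (d m n : nat) :
  \sum_(k \in [set: int]) catalan_triangle d m k * catalan_triangle d n k =
  (\sum_(k \in [set k : int | 0 < k])
     catalan_triangle d m k * catalan_triangle d n k) *+ 2.
Proof.
apply: fsum_even => [||k]; first exact: finite_catalan_triangleM.
  by rewrite catalan_triangle0 mul0r.
by rewrite !catalan_triangleN mulrNN.
Qed.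

Theorem proposition3p6 (d : nat) (hd : (2 <= d)%N) (n : nat) :
  catalan_triangle d (2 * n)%N 1 =
  \sum_(k \in [set k : int | 0 < k]) catalan_triangle d n k ^+ 2.
Proof.
have := fsum_catalan_triangle_shift d n n.
rewrite !fsum_catalan_triangle_half addnn -mul2n.
move=> /eqP; rewrite eqrMn2r => /eqP.
under [RHS]eq_fsbigr do rewrite -expr2.
move=> <-; rewrite -(fsbig_widen [set 1]) ?fsbig_set1.
- by rewrite mul1r.
- by move=> k ->.
- by move=> k [/= k0 /eqP/negPf k1]; rewrite k1 ifF ?mul0r//; lia.
Qed.
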